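(* Up to isomorphism there are exactly four bialgebras of dimension $2$ over $\mathbb{F}_2$. With basis $1,x$ they are: (1) $x^2=0$, $\Delta x=x\otimes 1+1\otimes x+x\otimes x$, $\epsilon(x)=0$ (the group algebra $\mathbb{F}_2\mathbb{Z}_2$, with $1+x$ grouplike); (2) $x^2=0$, $\Delta x=x\otimes 1+1\otimes x$, $\epsilon(x)=0$ (the Grassmann line); (3) $x^2=x$, $\Delta x=x\otimes 1+1\otimes x$, $\epsilon(x)=0$ (the algebra $\mathbb{F}_2(\mathbb{Z}_2)$ of functions on $\mathbb{Z}_2$); (4) $x^2=x$, $\Delta x=x\otimes x$, $\epsilon(x)=1$. The first three are Hopf algebras, each with antipode $S=\mathrm{id}$, and the fourth is not a Hopf algebra. The bialgebras (2) and (4) are self-dual, and (1) and (3) are dual to each other.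
   Context: Algebras are unital associative and coalgebras counital coassociative; in a bialgebra $\Delta$ and $\epsilon$ are unital algebra homomorphisms; a Hopf algebra is a bialgebra admitting an antipode. Isomorphisms of bialgebras are linear bijections that are algebra and coalgebra maps. The dual of a finite-dimensional bialgebra $H$ is $H^*$ with product dual to $\Delta$ and coproduct dual to the product, and $H$ is self-dual if $H\cong H^*$ as bialgebras. *)

(* Defs.v *)
From HB Require Import structures.
From mathcomp Require Import all_boot all_order all_algebra all_fingroup all_field.

Set Implicit Arguments.
Unset Strict Implicit.
Unset Printing Implicit Defensive.

Import GRing.Theory.
Local Open Scope ring_scope.

(* A model of the tensor product of finite-dimensional vector spaces: the     *)
(* matrix t stands for the tensor \sum_(i, j) t i j *: (e_i (x) e'_j), where  *)
(* e and e' are the bases vbasis {:U} and vbasis {:V}. Its universal property *)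
(* is tlift_pure and tlift_uniq below, so nothing depends on these bases.     *)
Definition tensor (F : fieldType) (U V : vectType F) : Type :=
  'M[F]_(\dim {:U}, \dim {:V}).

HB.instance Definition _ (F : fieldType) (U V : vectType F) :=
  Vector.copy (tensor U V) 'M[F]_(\dim {:U}, \dim {:V}).

Section Tensor.
Variable F : fieldType.
Implicit Types U V W : vectType F.

Definition tpure U V (u : U) (v : V) : tensor U V :=
  (\matrix_(i, j) (coord (vbasis {:U}) i u * coord (vbasis {:V}) j v))%R.

(* The linear map on U (x) V induced by f, when f is bilinear. *)
Definition tlift U V (W : lmodType F) (f : U -> V -> W) (t : tensor U V) : W :=
  \sum_i \sum_j (t : 'M[F]_(_, _)) i j *:
     f (vbasis {:U})`_i (vbasis {:V})`_j.

Definition tmap U V U' V' (f : U -> U') (g : V -> V') :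
    tensor U V -> tensor U' V' :=
  tlift (fun u v => tpure (f u) (g v)).

Definition tassoc U V W :
    tensor (tensor U V) W -> tensor U (tensor V W) :=
  tlift (fun t w => tlift (fun u v => tpure u (tpure v w)) t).

Definition tmul (A B : falgType F) (s t : tensor A B) : tensor A B :=
  tlift (fun a b => tlift (fun c d => tpure (a * c) (b * d)) t) s.

End Tensor.

Notation "u *t v" := (tpure u v) (at level 40, left associativity).

HB.mixin Record isBialgebra (F : fieldType) H of Falgebra F H := {
  comul_subdef : 'Hom(H, tensor H H);
  counit_subdef : 'Hom(H, F^o);
  comulA_subproof : forall h,
    tassoc (tmap comul_subdef idfun (comul_subdef h))
    = tmap idfun comul_subdef (comul_subdef h);
  counitl_subproof : forall h,
    tlift (fun a b => (counit_subdef a : F) *: b) (comul_subdef h) = h;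
  counitr_subproof : forall h,
    tlift (fun a b => (counit_subdef b : F) *: a) (comul_subdef h) = h;
  comul1_subproof : comul_subdef 1 = (1 : H) *t (1 : H);
  comulM_subproof : forall a b : H,
    comul_subdef (a * b) = tmul (comul_subdef a) (comul_subdef b);
  counit1_subproof : counit_subdef 1 = 1;
  counitM_subproof : forall a b : H,
    counit_subdef (a * b) = counit_subdef a * counit_subdef b
}.

#[short(type="bialgType")]
HB.structure Definition Bialgebra (F : fieldType) :=
  { H of isBialgebra F H & Falgebra F H }.

Section BialgebraTheory.
Variables (F : fieldType) (H : bialgType F).

Definition comul : 'Hom(H, tensor H H) := comul_subdef.
Definition counit : 'Hom(H, F^o) := counit_subdef.

Lemma comulA h :
  tassoc (tmap comul idfun (comul h)) = tmap idfun comul (comul h).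
Proof. exact: comulA_subproof. Qed.

Lemma counitl h : tlift (fun a b => (counit a : F) *: b) (comul h) = h.
Proof. exact: counitl_subproof. Qed.

Lemma counitr h : tlift (fun a b => (counit b : F) *: a) (comul h) = h.
Proof. exact: counitr_subproof. Qed.

Lemma comul1 : comul 1 = 1 *t 1.
Proof. exact: comul1_subproof. Qed.

Lemma comulM a b : comul (a * b) = tmul (comul a) (comul b).
Proof. exact: comulM_subproof. Qed.

Lemma counit1 : counit 1 = 1.
Proof. exact: counit1_subproof. Qed.

Lemma counitM a b : counit (a * b) = counit a * counit b.
Proof. exact: counitM_subproof. Qed.

End BialgebraTheory.

Arguments comul {F H}.
Arguments counit {F H}.

Section TensorTheory.
Variable F : fieldType.
Implicit Types U V : vectType F.

Lemma tensorE U V (t : tensor U V) :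
  t = \sum_i \sum_j (t : 'M[F]_(_, _)) i j *:
        ((vbasis {:U})`_i *t (vbasis {:V})`_j).
Proof.
apply/matrixP=> i j; rewrite summxE (bigD1 i) //= summxE (bigD1 j) //= !mxE.
rewrite !coord_free ?(basis_free (vbasisP _)) // !eqxx !mulr1.
rewrite big1 ?addr0 => [|k /negPf kj]; last first.
  rewrite !mxE !coord_free ?(basis_free (vbasisP _)) // kj.
  by rewrite !mulr0.
rewrite big1 ?addr0 // => k /negPf ki; rewrite summxE big1 // => l _.
rewrite !mxE !coord_free ?(basis_free (vbasisP _)) // ki.
by rewrite mul0r mulr0.
Qed.

Lemma tlift_is_linear U V (W : lmodType F) (f : U -> V -> W) :
  linear (tlift f).
Proof.
move=> a s t; rewrite /tlift scaler_sumr -big_split; apply: eq_bigr => i _ /=.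
rewrite scaler_sumr -big_split; apply: eq_bigr => j _ /=.
by rewrite !mxE scalerDl scalerA.
Qed.

HB.instance Definition _ U V (W : lmodType F) (f : U -> V -> W) :=
  GRing.isLinear.Build F (tensor U V) W _ (tlift f) (tlift_is_linear f).

Lemma tlift_pure U V (W : lmodType F) (f : U -> V -> W) u v :
  (forall x, linear (f x)) -> (forall y, linear (f^~ y)) ->
  tlift f (u *t v) = f u v.
Proof.
move=> fl fr.
have suml n (c : 'I_n -> F) (y : 'I_n -> V) x :
    f x (\sum_i c i *: y i) = \sum_i c i *: f x (y i).
  pose g : {linear V -> W} := HB.pack (f x) (GRing.isLinear.Build _ _ _ _ _ (fl x)).
  by rewrite -[f x]/(g : V -> W) linear_sum; apply: eq_bigr => i _; rewrite linearZ.
have sumr n (c : 'I_n -> F) (x : 'I_n -> U) y :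
    f (\sum_i c i *: x i) y = \sum_i c i *: f (x i) y.
  pose g : {linear U -> W} := HB.pack (f^~ y) (GRing.isLinear.Build _ _ _ _ _ (fr y)).
  rewrite -[f _ y]/(g _) linear_sum; apply: eq_bigr => i _.
  by rewrite linearZ.
rewrite {2}(coord_vbasis (memvf u)) sumr; apply: eq_bigr => i _.
rewrite {2}(coord_vbasis (memvf v)) suml scaler_sumr.
by apply: eq_bigr => j _; rewrite mxE scalerA.
Qed.

Lemma tlift_uniq U V (W : lmodType F) (g h : {linear tensor U V -> W}) :
  (forall u v, g (u *t v) = h (u *t v)) -> g =1 h.
Proof.
move=> gh t; rewrite (tensorE t) !linear_sum; apply: eq_bigr => i _.
by rewrite !linear_sum; apply: eq_bigr => j _; rewrite !linearZ gh.
Qed.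

Lemma linear_tlift U V (W W' : lmodType F) (g : {linear W -> W'})
    (f : U -> V -> W) t : g (tlift f t) = tlift (fun u v => g (f u v)) t.
Proof.
rewrite /tlift linear_sum; apply: eq_bigr => i _.
by rewrite linear_sum; apply: eq_bigr => j _; rewrite linearZ.
Qed.

Lemma eq_tlift U V (W : lmodType F) (f g : U -> V -> W) t :
  (forall u v, f u v = g u v) -> tlift f t = tlift g t.
Proof.
by move=> fg; apply: eq_bigr => i _; apply: eq_bigr => j _; rewrite fg.
Qed.

Lemma tpure_linr U V (u : U) : linear (tpure u : V -> _).
Proof.
by move=> a v w; apply/matrixP=> i j; rewrite !mxE linearP mulrDr mulrCA.
Qed.

Lemma tpure_linl U V (v : V) : linear ((@tpure F U V)^~ v).
Proof.
by move=> a u w; apply/matrixP=> i j; rewrite !mxE linearP mulrDl mulrA.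
Qed.

End TensorTheory.

Section TensorMaps.
Variable F : fieldType.
Implicit Types U V W : vectType F.

Lemma tliftZ U V (W : lmodType F) (f : U -> V -> W) a t :
  tlift (fun u v => a *: f u v) t = a *: tlift f t.
Proof.
rewrite /tlift scaler_sumr; apply: eq_bigr => i _; rewrite scaler_sumr.
by apply: eq_bigr => j _; rewrite !scalerA mulrC.
Qed.

Lemma tliftD U V (W : lmodType F) (f g : U -> V -> W) t :
  tlift (fun u v => f u v + g u v) t = tlift f t + tlift g t.
Proof.
rewrite /tlift -big_split; apply: eq_bigr => i _ /=.
by rewrite -big_split; apply: eq_bigr => j _ /=; rewrite scalerDr.
Qed.

Lemma tlift_exchange U V U' V' (W : lmodType F)
    (f : U -> V -> U' -> V' -> W) s t :
  tlift (fun a b => tlift (f a b) t) s =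
  tlift (fun c d => tlift (fun a b => f a b c d) s) t.
Proof.
rewrite [RHS]/tlift.
under [RHS]eq_bigr => k _ do under eq_bigr => l _ do rewrite -tliftZ.
pose L k l a b : W :=
  (t : 'M[F]_(_, _)) k l *: f a b (vbasis {:U'})`_k (vbasis {:V'})`_l.
transitivity (\sum_k \sum_l tlift (L k l) s) => //.
rewrite /tlift -/(L _ _ _ _).
under [RHS]eq_bigr => k _ do rewrite exchange_big.
rewrite [RHS]exchange_big; apply: eq_bigr => i _ /=.
under [RHS]eq_bigr => k _ do rewrite exchange_big.
rewrite [RHS]exchange_big; apply: eq_bigr => j _ /=.
rewrite scaler_sumr; apply: eq_bigr => k _ /=.
by rewrite scaler_sumr; apply: eq_bigr.
Qed.

Lemma tassoc_pure U V W (t : tensor U V) (w : W) :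
  tassoc (t *t w) = tlift (fun u v => u *t (v *t w)) t.
Proof.
rewrite /tassoc tlift_pure // => [s a x y|y].
  rewrite -tliftZ -tliftD; apply: eq_tlift => u v.
  by rewrite !(tpure_linr v, tpure_linr u).
exact: tlift_is_linear.
Qed.

HB.instance Definition _ U V U' V' (f : U -> U') (g : V -> V') :=
  GRing.Linear.copy (tmap f g) (tlift (fun u v => f u *t g v)).

HB.instance Definition _ U V W :=
  GRing.Linear.copy (@tassoc F U V W)
    (tlift (fun t w => tlift (fun u v => u *t (v *t w)) t)).

Lemma tmap_pure U V U' V' (f : {linear U -> U'}) (g : {linear V -> V'}) u v :
  tmap f g (u *t v) = f u *t g v.
Proof.
rewrite /tmap tlift_pure // => [x a y z|y a x z].
  by rewrite linearP tpure_linr.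
by rewrite linearP tpure_linl.
Qed.

Lemma tlift_tlift U V U' V' (W : lmodType F) (g : U' -> V' -> W)
    (f : U -> V -> tensor U' V') t :
  tlift g (tlift f t) = tlift (fun u v => tlift g (f u v)) t.
Proof. exact: linear_tlift. Qed.

Lemma tassoc_tlift U V U' V' W' (f : U -> V -> tensor (tensor U' V') W') t :
  tassoc (tlift f t) = tlift (fun u v => tassoc (f u v)) t.
Proof. exact: linear_tlift. Qed.

Lemma tlift_mull U V (f : U -> V -> F^o) (a : F^o) t :
  tlift (fun u v => a * f u v) t = a * tlift f t.
Proof. exact: (@tliftZ _ _ F^o). Qed.

Lemma tlift_mulr U V (f : U -> V -> F^o) (a : F^o) t :
  tlift (fun u v => f u v * a) t = tlift f t * a.
Proof.
by rewrite [RHS]mulrC -tlift_mull; apply: eq_tlift => u v; apply: mulrC.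
Qed.

Lemma tassoc_comb U V W n m (c : 'I_n -> 'I_m -> F)
    (x : 'I_n -> 'I_m -> tensor (tensor U V) W) :
  tassoc (\sum_i \sum_j c i j *: x i j) = \sum_i \sum_j c i j *: tassoc (x i j).
Proof.
rewrite linear_sum; apply: eq_bigr => i _; rewrite linear_sum.
by apply: eq_bigr => j _; rewrite linearZ.
Qed.

Lemma tmap_comb U V U' V' (f : U -> U') (g : V -> V') n m
    (c : 'I_n -> 'I_m -> F) (x : 'I_n -> 'I_m -> tensor U V) :
  tmap f g (\sum_i \sum_j c i j *: x i j) =
  \sum_i \sum_j c i j *: tmap f g (x i j).
Proof.
rewrite linear_sum; apply: eq_bigr => i _; rewrite linear_sum.
by apply: eq_bigr => j _; rewrite linearZ.
Qed.

Lemma tlift_comb U V (W : lmodType F) (f : U -> V -> W) n m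
    (c : 'I_n -> 'I_m -> F) (x : 'I_n -> 'I_m -> tensor U V) :
  tlift f (\sum_i \sum_j c i j *: x i j) =
  \sum_i \sum_j c i j *: tlift f (x i j).
Proof.
rewrite linear_sum; apply: eq_bigr => i _; rewrite linear_sum.
by apply: eq_bigr => j _; rewrite linearZ.
Qed.

Lemma tpure_comb U V (u : U) n m
    (c : 'I_n -> 'I_m -> F) (x : 'I_n -> 'I_m -> V) :
  u *t (\sum_i \sum_j c i j *: x i j) = \sum_i \sum_j c i j *: (u *t x i j).
Proof.
pose L : {linear V -> tensor U V} := HB.pack (tpure u : V -> tensor U V)
  (GRing.isLinear.Build _ _ _ _ _ (@tpure_linr F _ _ u)).
rewrite -[LHS]/(L _) linear_sum; apply: eq_bigr => i _; rewrite linear_sum.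
by apply: eq_bigr => j _; rewrite linearZ.
Qed.

End TensorMaps.

(* The dual vector space H^*, carrying the transposed bialgebra structure. *)
Definition dual (F : fieldType) (H : bialgType F) : Type := 'Hom(H, F^o).

HB.instance Definition _ (F : fieldType) (H : bialgType F) :=
  Vector.copy (dual H) 'Hom(H, F^o).

Section Dual.
Variables (F : fieldType) (H : bialgType F).
Local Notation n := (\dim {:H}).
Local Notation b := (vbasis {:H}).
Implicit Types (phi psi : dual H) (h : H).

Definition dual_eval phi h : F^o := (phi : 'Hom(H, F^o)) h.

Definition dual_one : dual H := counit.

Definition dual_mul phi psi : dual H :=
  linfun (fun h => tlift (fun u v => dual_eval phi u * dual_eval psi v)
                     (comul h) : F^o).

Definition dual_basis (i : 'I_n) : dual H := linfun (coord b i : H -> F^o).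

(* The transpose of the product, H^* -> (H (x) H)^* = H^* (x) H^*; see
   dual_comulP and dual_comul_uniq. *)
Definition dual_comul_fun phi : tensor (dual H) (dual H) :=
  \sum_(i < n) \sum_(j < n) (dual_eval phi (b`_i * b`_j) : F) *:
     (dual_basis i *t dual_basis j).

Definition dual_counit_fun phi : F^o := dual_eval phi 1.

Definition dual_pair (g h : H) (t : tensor (dual H) (dual H)) : F^o :=
  tlift (fun phi psi => dual_eval phi g * dual_eval psi h) t.

Lemma dual_eqP phi psi :
  (forall h, dual_eval phi h = dual_eval psi h) <-> phi = psi.
Proof. by split=> [e|-> //]; apply/lfunP. Qed.

Lemma dual_eval_is_linear phi : linear (dual_eval phi).
Proof. by move=> a g h; rewrite /dual_eval linearP. Qed.

HB.instance Definition _ phi :=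
  GRing.isLinear.Build F H F^o _ (dual_eval phi) (dual_eval_is_linear phi).

Lemma dual_evalP a phi psi h :
  dual_eval (a *: phi + psi) h = a *: dual_eval phi h + dual_eval psi h.
Proof. by rewrite /dual_eval lfunE /= lfunE. Qed.

Lemma dual_mulE phi psi h :
  dual_eval (dual_mul phi psi) h =
  tlift (fun u v => dual_eval phi u * dual_eval psi v : F^o) (comul h).
Proof.
pose f h : F^o := tlift (fun u v => dual_eval phi u * dual_eval psi v : F^o)
                   (comul h).
have fl : linear f by move=> a u v; rewrite /f !linearP.
pose g : {linear H -> F^o} := HB.pack f (GRing.isLinear.Build _ _ _ _ _ fl).
by rewrite /dual_eval (lfunE g).
Qed.

Lemma dual_basisE i h : dual_eval (dual_basis i) h = coord b i h.
Proof. by rewrite /dual_eval lfunE. Qed.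

Lemma dual_basis_sum h : \sum_(i < n) (dual_eval (dual_basis i) h : F) *: b`_i = h.
Proof.
by rewrite [RHS](coord_vbasis (memvf h)); apply: eq_bigr => i _; rewrite dual_basisE.
Qed.

Lemma dual_evalE phi h :
  dual_eval phi h = \sum_(i < n) dual_eval (dual_basis i) h * dual_eval phi b`_i.
Proof. by rewrite -{1}(dual_basis_sum h) linear_sum; apply: eq_bigr => i _; rewrite linearZ. Qed.

Lemma dual_sumE I (r : seq I) (P : pred I) (f : I -> dual H) h :
  dual_eval (\sum_(i <- r | P i) f i) h = \sum_(i <- r | P i) dual_eval (f i) h.
Proof. by rewrite /dual_eval sum_lfunE. Qed.

Lemma dual_expand phi : phi = \sum_(i < n) (dual_eval phi b`_i : F) *: dual_basis i.
Proof.
apply/dual_eqP => h; rewrite dual_sumE dual_evalE.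
apply: eq_bigr => i _; rewrite -[_ *: _]addr0 dual_evalP /dual_eval zero_lfunE addr0.
exact: mulrC.
Qed.

Lemma dual_pair_pure phi psi g h :
  dual_pair g h (phi *t psi) = dual_eval phi g * dual_eval psi h.
Proof.
rewrite /dual_pair tlift_pure // => x a u v /=.
  by rewrite dual_evalP mulrDr mulrCA.
by rewrite dual_evalP mulrDl scalerAl.
Qed.

HB.instance Definition _ g h :=
  GRing.Linear.copy (dual_pair g h)
    (tlift (fun phi psi => dual_eval phi g * dual_eval psi h : F^o)).

Lemma dual_pair_expand t :
  t = \sum_(i < n) \sum_(j < n) (dual_pair b`_i b`_j t : F) *:
     (dual_basis i *t dual_basis j).
Proof.
pose f t : tensor (dual H) (dual H) :=
  \sum_(i < n) \sum_(j < n) (dual_pair b`_i b`_j t : F) *: (dual_basis i *t dual_basis j).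
have fl : linear f.
  move=> a u v; rewrite /f scaler_sumr -big_split; apply: eq_bigr => i _ /=.
  rewrite scaler_sumr -big_split; apply: eq_bigr => j _ /=.
  by rewrite linearP scalerDl scalerA.
pose g : {linear tensor (dual H) (dual H) -> _} :=
  HB.pack f (GRing.isLinear.Build _ _ _ _ _ fl).
apply: (tlift_uniq (g := idfun) (h := g)) => phi psi /=; rewrite /f.
transitivity (tlift (fun phi psi => phi *t psi) (phi *t psi)).
  by rewrite tlift_pure //; [exact: tpure_linr | exact: tpure_linl].
pose fr (u : dual H) : {linear dual H -> tensor (dual H) (dual H)} :=
  HB.pack (tpure u : dual H -> _) (GRing.isLinear.Build _ _ _ _ _ (@tpure_linr F _ _ u)).
pose fl' (v : dual H) : {linear dual H -> tensor (dual H) (dual H)} :=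
  HB.pack ((@tpure F (dual H) (dual H))^~ v) (GRing.isLinear.Build _ _ _ _ _ (@tpure_linl F _ _ v)).
rewrite tlift_pure; [|exact: tpure_linr | exact: tpure_linl].
rewrite {1}(dual_expand phi) -[_ *t _]/(fl' _ _) linear_sum; apply: eq_bigr => i _.
rewrite linearZ /= {1}(dual_expand psi) -[_ *t _]/(fr _ _) linear_sum scaler_sumr.
by apply: eq_bigr => j _; rewrite linearZ /= scalerA dual_pair_pure.
Qed.

Lemma dual_pair_inj t t' :
  (forall g h, dual_pair g h t = dual_pair g h t') -> t = t'.
Proof.
move=> e; rewrite (dual_pair_expand t) (dual_pair_expand t').
by apply: eq_bigr => i _; apply: eq_bigr => j _; rewrite e.
Qed.

Lemma dual_comulP phi g h :
  dual_pair g h (dual_comul_fun phi) = dual_eval phi (g * h).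
Proof.
rewrite linear_sum /=.
rewrite -[in RHS](dual_basis_sum g) mulr_suml linear_sum.
apply: eq_bigr => i _; rewrite linear_sum /= -scalerAl linearZ /=.
rewrite -[in RHS](dual_basis_sum h) mulr_sumr linear_sum scaler_sumr.
apply: eq_bigr => j _; rewrite linearZ /= -scalerAr linearZ /= dual_pair_pure.
by rewrite /GRing.scale /= mulrC mulrA.
Qed.

Lemma dual_comul_uniq phi t :
  (forall g h, dual_pair g h t = dual_eval phi (g * h)) ->
  t = dual_comul_fun phi.
Proof. by move=> e; apply: dual_pair_inj => g h; rewrite e dual_comulP. Qed.

End Dual.

Section DualInstances.
Variables (F : fieldType) (H : bialgType F).
Local Notation n := (\dim {:H}).
Local Notation b := (vbasis {:H}).
Implicit Types phi psi chi : dual H.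

Lemma dual_mulA : associative (@dual_mul F H).
Proof.
move=> phi psi chi; apply/dual_eqP => h; rewrite !dual_mulE.
pose f u t : F^o := dual_eval phi u *
  tlift (fun a c => dual_eval psi a * dual_eval chi c : F^o) t.
have fP u t : tlift f (u *t t) = f u t.
  rewrite tlift_pure // /f => x a y z.
    by rewrite linearP mulrDr scalerAr.
  by rewrite linearP mulrDl scalerAl.
transitivity (tlift f (tmap idfun comul (comul h))).
  rewrite /tmap tlift_tlift; apply: eq_tlift => u v.
  by rewrite fP dual_mulE.
rewrite -comulA /tmap tassoc_tlift.
rewrite tlift_tlift; apply: eq_tlift => u v.
rewrite tassoc_pure tlift_tlift dual_mulE.
rewrite -tlift_mulr; apply: eq_tlift => a c; rewrite fP /f tlift_pure.
- by rewrite mulrA.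
- by move=> x k y z; rewrite linearP mulrDr scalerAr.
- by move=> x k y z; rewrite linearP mulrDl scalerAl.
Qed.

Lemma dual_mul1l : left_id (@dual_one F H) (@dual_mul F H).
Proof.
move=> phi; apply/dual_eqP => h; rewrite dual_mulE.
rewrite -[in RHS](counitl h) linear_tlift; apply: eq_tlift => u v.
by rewrite linearZ.
Qed.

Lemma dual_mul1r : right_id (@dual_one F H) (@dual_mul F H).
Proof.
move=> phi; apply/dual_eqP => h; rewrite dual_mulE.
rewrite -[in RHS](counitr h) linear_tlift; apply: eq_tlift => u v.
by rewrite linearZ; apply: mulrC.
Qed.

Lemma dual_mul_linl psi : linear ((@dual_mul F H)^~ psi).
Proof.
move=> a phi phi'; apply/dual_eqP => h.
rewrite dual_evalP !dual_mulE -tliftZ -tliftD; apply: eq_tlift => u v.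
by rewrite dual_evalP mulrDl scalerAl.
Qed.

Lemma dual_mul_linr phi : linear (dual_mul phi).
Proof.
move=> a psi psi'; apply/dual_eqP => h.
rewrite dual_evalP !dual_mulE -tliftZ -tliftD; apply: eq_tlift => u v.
by rewrite dual_evalP mulrDr scalerAr.
Qed.

Lemma dual_mulDl : left_distributive (@dual_mul F H) +%R.
Proof. by move=> x y z; have := dual_mul_linl z 1 x y; rewrite !scale1r. Qed.

Lemma dual_mulDr : right_distributive (@dual_mul F H) +%R.
Proof. by move=> x y z; have := dual_mul_linr x 1 y z; rewrite !scale1r. Qed.

Lemma dual_one_neq0 : dual_one H != 0.
Proof.
apply/eqP => /dual_eqP /(_ 1); rewrite /dual_eval counit1 zero_lfunE.
by move/eqP; rewrite oner_eq0.
Qed.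

HB.instance Definition _ := GRing.Zmodule_isNzRing.Build (dual H)
  dual_mulA dual_mul1l dual_mul1r dual_mulDl dual_mulDr dual_one_neq0.

Lemma dual_mul0l phi : dual_mul 0 phi = 0. Proof. exact: mul0r. Qed.

Lemma dual_scalerAl (a : F) phi psi : a *: (phi * psi) = (a *: phi) * psi.
Proof.
by have := dual_mul_linl psi a phi 0; rewrite dual_mul0l !addr0 => <-.
Qed.

Lemma dual_scalerAr (a : F) phi psi : a *: (phi * psi) = phi * (a *: psi).
Proof.
have := dual_mul_linr phi a psi 0.
by rewrite -[dual_mul phi 0]/(phi * 0) mulr0 !addr0 => <-.
Qed.

HB.instance Definition _ :=
  GRing.Lmodule_isLalgebra.Build F (dual H) dual_scalerAl.
HB.instance Definition _ :=
  GRing.Lalgebra_isAlgebra.Build F (dual H) dual_scalerAr.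
HB.instance Definition _ := Algebra_isFalgebra.Build F (dual H).

Lemma dual_pairP g h a s t : @dual_pair F H g h (a *: s + t) =
  a *: dual_pair g h s + dual_pair g h t.
Proof. exact: linearP. Qed.

Lemma dual_comul_fun_is_linear : linear (@dual_comul_fun F H).
Proof.
move=> a phi psi; apply: dual_pair_inj => g h.
by rewrite dual_pairP !dual_comulP dual_evalP.
Qed.

HB.instance Definition _ := GRing.isLinear.Build F (dual H)
  (tensor (dual H) (dual H)) _ (@dual_comul_fun F H) dual_comul_fun_is_linear.

Lemma dual_counit_fun_is_linear : linear (@dual_counit_fun F H).
Proof. by move=> a phi psi; rewrite /dual_counit_fun dual_evalP. Qed.

HB.instance Definition _ := GRing.isLinear.Build F (dual H) F^o _
  (@dual_counit_fun F H) dual_counit_fun_is_linear.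

Definition dual_comul : 'Hom(dual H, tensor (dual H) (dual H)) :=
  linfun (@dual_comul_fun F H).

Definition dual_counit : 'Hom(dual H, F^o) := linfun (@dual_counit_fun F H).

Lemma dual_comulE phi : dual_comul phi = dual_comul_fun phi.
Proof. exact: lfunE. Qed.

Lemma dual_counitE phi : dual_counit phi = dual_eval phi 1.
Proof. exact: lfunE. Qed.

Lemma tmap_dual_comull phi psi :
  tmap dual_comul idfun (phi *t psi) = dual_comul_fun phi *t psi.
Proof. by rewrite -dual_comulE; exact: tmap_pure. Qed.

Lemma tmap_dual_comulr phi psi :
  tmap idfun dual_comul (phi *t psi) = phi *t dual_comul_fun psi.
Proof. by rewrite -dual_comulE; exact: tmap_pure. Qed.

Lemma dual_pair_tlift (U V : vectType F) (f : U -> V -> tensor (dual H) (dual H)) (t : tensor U V) g h :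
  dual_pair g h (tlift f t) = tlift (fun u v => dual_pair g h (f u v)) t.
Proof. exact: linear_tlift. Qed.

Let tsum3 (f : 'I_n -> 'I_n -> 'I_n -> F) : tensor (dual H) _ :=
  \sum_(k < n) \sum_(l < n) \sum_(j < n)
    f k l j *: (@dual_basis F H k *t (@dual_basis F H l *t @dual_basis F H j)).

Lemma dual_comulA phi :
  tassoc (tmap dual_comul idfun (dual_comul phi)) =
  tmap idfun dual_comul (dual_comul phi).
Proof.
pose P k l j := dual_eval phi (b`_k * b`_l * b`_j) : F.
transitivity (tsum3 P).
  rewrite dual_comulE [in LHS]/dual_comul_fun.
  rewrite tmap_comb tassoc_comb.
  transitivity (\sum_(i < n) \sum_(j < n) \sum_(k < n) \sum_(l < n)
    (dual_eval phi (b`_i * b`_j) * dual_eval (dual_basis i) (b`_k * b`_l) : F)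
      *: (@dual_basis F H k *t (@dual_basis F H l *t @dual_basis F H j))).
    apply: eq_bigr => i _; apply: eq_bigr => j _.
    rewrite tmap_dual_comull tassoc_pure.
    rewrite tlift_comb scaler_sumr; apply: eq_bigr => k _.
    rewrite scaler_sumr; apply: eq_bigr => l _.
    rewrite scalerA tlift_pure //.
      by move=> x a y z; rewrite !(tpure_linr x, tpure_linl).
    by move=> x; apply: tpure_linl.
  under eq_bigr => i _ do rewrite exchange_big; rewrite exchange_big /=.
  apply: eq_bigr => k _; under eq_bigr => i _ do rewrite exchange_big.
  rewrite exchange_big /=; apply: eq_bigr => l _.
  rewrite exchange_big /=; apply: eq_bigr => j _.
  rewrite -scaler_suml; congr (_ *: _).
  rewrite /P -[in RHS](dual_basis_sum (b`_k * b`_l)) mulr_suml linear_sum.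
  by apply: eq_bigr => i _; rewrite -scalerAl linearZ mulrC.
rewrite dual_comulE [in RHS]/dual_comul_fun tmap_comb.
apply: eq_bigr => k _.
transitivity (\sum_(i < n) \sum_(l < n) \sum_(j < n)
    (dual_eval phi (b`_k * b`_i) * dual_eval (dual_basis i) (b`_l * b`_j) : F)
      *: (@dual_basis F H k *t (@dual_basis F H l *t @dual_basis F H j))).
  rewrite [RHS]exchange_big /=; apply: eq_bigr => l _.
  rewrite [RHS]exchange_big /=; apply: eq_bigr => j _.
  rewrite -scaler_suml; congr (_ *: _).
  rewrite /P -mulrA -[in LHS](dual_basis_sum (b`_l * b`_j)) mulr_sumr linear_sum.
  by apply: eq_bigr => i _; rewrite -scalerAr linearZ mulrC.
apply: eq_bigr => i _; rewrite tmap_dual_comulr tpure_comb scaler_sumr.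
apply: eq_bigr => l _; rewrite scaler_sumr.
by apply: eq_bigr => j _; rewrite scalerA.
Qed.

Lemma dual_counitl phi :
  tlift (fun u v => (dual_counit u : F) *: v) (dual_comul phi) = phi.
Proof.
apply/dual_eqP => h; rewrite dual_comulE.
pose E : {linear dual H -> F^o} := HB.pack (fun phi : dual H => dual_eval phi h)
  (GRing.isLinear.Build _ _ _ _ _ (fun a x y => dual_evalP a x y h)).
rewrite -[LHS]/(E _) linear_tlift -[h in RHS]mul1r -dual_comulP.
by apply: eq_tlift => u v; rewrite linearZ dual_counitE.
Qed.

Lemma dual_counitr phi :
  tlift (fun u v => (dual_counit v : F) *: u) (dual_comul phi) = phi.
Proof.
apply/dual_eqP => h; rewrite dual_comulE.
pose E : {linear dual H -> F^o} := HB.pack (fun phi : dual H => dual_eval phi h)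
  (GRing.isLinear.Build _ _ _ _ _ (fun a x y => dual_evalP a x y h)).
rewrite -[LHS]/(E _) linear_tlift -[h in RHS]mulr1 -dual_comulP.
by apply: eq_tlift => u v; rewrite linearZ dual_counitE; apply: mulrC.
Qed.

Lemma dual_comul1 : dual_comul 1 = (1 : dual H) *t (1 : dual H).
Proof.
rewrite dual_comulE; symmetry; apply: dual_comul_uniq => g h.
by rewrite dual_pair_pure; symmetry; apply: counitM.
Qed.

Lemma dual_comulM phi psi : dual_comul (phi * psi) = tmul (dual_comul phi) (dual_comul psi).
Proof.
rewrite !dual_comulE; symmetry; apply: dual_comul_uniq => g h.
rewrite dual_mulE comulM [in RHS]/tmul tlift_tlift [in LHS]/tmul dual_pair_tlift.
transitivity (tlift (fun p q => tlift (fun r s =>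
   tlift (fun x y => tlift (fun z w =>
     (dual_eval p x * dual_eval q z) * (dual_eval r y * dual_eval s w) : F^o)
     (comul h)) (comul g)) (dual_comul_fun psi)) (dual_comul_fun phi)).
  apply: eq_tlift => p q; rewrite dual_pair_tlift; apply: eq_tlift => r s.
  rewrite dual_pair_pure !dual_mulE -tlift_mulr; apply: eq_tlift => x y.
  by rewrite -tlift_mull; apply: eq_tlift => z w; rewrite mulrACA.
transitivity (tlift (fun x y => tlift (fun z w =>
   tlift (fun p q => tlift (fun r s =>
     (dual_eval p x * dual_eval q z) * (dual_eval r y * dual_eval s w) : F^o)
     (dual_comul_fun psi)) (dual_comul_fun phi)) (comul h)) (comul g)).
  under eq_tlift => p q do rewrite tlift_exchange.
  rewrite tlift_exchange; apply: eq_tlift => x y.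
  under eq_tlift => p q do rewrite tlift_exchange.
  by rewrite tlift_exchange.
apply: eq_tlift => x y; rewrite tlift_tlift; apply: eq_tlift => z w.
rewrite tlift_pure; last 2 first.
- by move=> u k v v'; rewrite linearP mulrDr scalerAr.
- by move=> u k v v'; rewrite linearP mulrDl scalerAl.
rewrite -!dual_comulP -tlift_mulr; apply: eq_tlift => p q.
by rewrite -tlift_mull.
Qed.

Lemma dual_counit1 : dual_counit 1 = 1.
Proof. by rewrite dual_counitE; apply: counit1. Qed.

Lemma dual_counitM phi psi : dual_counit (phi * psi) = dual_counit phi * dual_counit psi.
Proof.
rewrite !dual_counitE dual_mulE comul1 tlift_pure // => x k y z.
  by rewrite linearP mulrDr scalerAr.
by rewrite linearP mulrDl scalerAl.
Qed.

HB.instance Definition _ := isBialgebra.Build F (dual H)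
  dual_comulA dual_counitl dual_counitr
  dual_comul1 dual_comulM dual_counit1 dual_counitM.

End DualInstances.

Section BialgebraDefs.
Variable F : fieldType.
Implicit Types H K : bialgType F.

Definition bialg_iso H K : Prop :=
  exists f : {lrmorphism H -> K},
    [/\ bijective f,
        forall h, comul (f h) = tmap f f (comul h)
      & forall h, counit (f h) = counit h].

Definition self_dual H : Prop := bialg_iso H (dual H).

Definition antipode H (S : 'End(H)) : Prop :=
  forall h : H,
    tlift (fun a b => S a * b) (comul h) = (counit h : F)%:A /\
    tlift (fun a b => a * S b) (comul h) = (counit h : F)%:A.

Definition is_hopf H : Prop := exists S : 'End(H), antipode S.

Definition grouplike H (g : H) : Prop :=
  comul g = g *t g /\ counit g = 1.

(* e exhibits H as the group bialgebra F[gT], with e g the element of H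
   corresponding to g. *)
Definition group_bialg (gT : finGroupType) H (e : gT -> H) : Prop :=
  [/\ basis_of {:H} [seq e g | g <- enum gT],
      e 1%g = 1,
      forall g h, e (g * h)%g = e g * e h
    & forall g, grouplike (e g)].

(* theta identifies H with the bialgebra of functions gT -> F: the product is
   pointwise, (Delta f)(g, h) = f (g h) and epsilon f = f 1. *)
Definition function_bialg (gT : finGroupType) H
    (theta : {linear H -> {ffun gT -> F^o}}) : Prop :=
  [/\ bijective theta,
      forall g, theta 1 g = 1,
      forall a b g, theta (a * b) g = theta a g * theta b g,
      forall a g h, tlift (fun u v => theta u g * theta v h) (comul a)
                    = theta a (g * h)%g
    & forall a, counit a = theta a 1%g].

End BialgebraDefs.

(* Main.v *)
Require Import Defs.
From HB Require Import structures.
From mathcomp Require Import all_boot all_order all_algebra all_fingroup all_field.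
From mathcomp Require Import ring.

Set Implicit Arguments.
Unset Strict Implicit.
Unset Printing Implicit Defensive.

Import GRing.Theory.
Local Open Scope ring_scope.

(* In a two-dimensional bialgebra the augmentation ideal is a line F x, so    *)
(* x^2 = a x, and the counit axioms force Delta x = x (x) 1 + 1 (x) x +       *)
(* c x (x) x.  The pair (a, c) determines the bialgebra, and over F_2, where  *)
(* x is unique and every pair occurs, it is a complete invariant.  The        *)
(* functional dual to x satisfies the same relations with a and c exchanged,  *)
(* which gives all the dualities.  The fourth bialgebra is (1, 1), with       *)
(* generator 1 + x instead of x.                                              *)

(** [exists_pointed_basis] puts every two-dimensional bialgebra into the normal form
    [pointed_basis x a c], and [pointed_basis_iso] shows that equal parameters give isomorphic
    bialgebras. Over F_2 the converse holds ([pointed_basis_iso_eq]): 1 is the only nonzero scalar,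
    so an isomorphism must carry generator to generator.

    Conversely, coassociativity and the counit laws hold for all parameters, and Delta is
    multiplicative as soon as (1 + a c) (2 + a c) = 0. Over F_2 this always holds, so [bialg2]
    realises all four pairs; (0, 1), (0, 0), (1, 0), (1, 1) are the bialgebras (1) to (4).

    [pointed_basis_dual] exchanges [a] and [c], so (0, 0) and (1, 1) are self-dual while (0, 1) and
    (1, 0) are dual to each other. The identity is an antipode when 2 + c a = 0, which over F_2
    leaves out only (1, 1); there [1 + x] is a grouplike idempotent different from 1, which no
    antipode tolerates. *)

Section Tensors.
Variable F : fieldType.
Implicit Types U V W : vectType F.

Lemma tpureDl U V (u u' : U) (v : V) : (u + u') *t v = u *t v + u' *t v.
Proof. by have := tpure_linl v 1 u u'; rewrite !scale1r. Qed.

Lemma tpureDr U V (u : U) (v v' : V) : u *t (v + v') = u *t v + u *t v'.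
Proof. by have := tpure_linr u 1 v v'; rewrite !scale1r. Qed.

Lemma tpure0l U V (v : V) : (0 : U) *t v = 0.
Proof. by apply/matrixP => i j; rewrite !mxE linear0 mul0r. Qed.

Lemma tpure0r U V (u : U) : u *t (0 : V) = 0.
Proof. by apply/matrixP => i j; rewrite !mxE linear0 mulr0. Qed.

Lemma tpureZl U V a (u : U) (v : V) : (a *: u) *t v = a *: (u *t v).
Proof. by have := tpure_linl v a u 0; rewrite tpure0l !addr0. Qed.

Lemma tpureZr U V a (u : U) (v : V) : u *t (a *: v) = a *: (u *t v).
Proof. by have := tpure_linr u a v 0; rewrite tpure0r !addr0. Qed.

(** A nonzero coordinate of [u] forces every coordinate of [v] to vanish. Applied to a tensor square
    of the generator, this makes the parameter [c] readable from the coproduct. *)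
Lemma tpure_eq0 U V (u : U) (v : V) : u *t v = 0 -> u = 0 \/ v = 0.
Proof.
move=> uv0; have [->|u0] := eqVneq u 0; first by left.
right; have [i ui] : exists i, coord (vbasis {:U}) i u != 0.
  apply/existsP; apply: contraNT u0; rewrite negb_exists => /forallP u0.
  rewrite (coord_vbasis (memvf u)) big1 // => i _.
  by have /eqP -> := negPn (u0 i); rewrite scale0r.
rewrite (coord_vbasis (memvf v)) big1 // => j _.
have /eqP := congr1 (fun t : tensor U V => (t : 'M_(_, _)) i j) uv0.
by rewrite !mxE mulf_eq0 (negPf ui) => /eqP ->; rewrite scale0r.
Qed.

Lemma tassoc_pure3 U V W (u : U) (v : V) (w : W) :
  tassoc (u *t v *t w) = u *t (v *t w).
Proof.
rewrite tassoc_pure tlift_pure // => [x k y z|y k x z].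
  by rewrite tpureDl tpureZl tpureDr tpureZr.
by rewrite tpureDl tpureZl.
Qed.

Variables A B : falgType F.
Implicit Types s t : tensor A B.

Lemma tmul_linl t : linear ((@tmul F A B)^~ t).
Proof. by move=> k s s'; rewrite /tmul linearP. Qed.

Lemma tmul_linr s : linear (tmul s).
Proof.
move=> k t t'; rewrite /tmul -tliftZ -tliftD; apply: eq_tlift => u v.
by rewrite linearP.
Qed.

Lemma tmulDl s s' t : tmul (s + s') t = tmul s t + tmul s' t.
Proof. by have := tmul_linl t 1 s s'; rewrite !scale1r. Qed.

Lemma tmulDr s t t' : tmul s (t + t') = tmul s t + tmul s t'.
Proof. by have := tmul_linr s 1 t t'; rewrite !scale1r. Qed.

Lemma tmulZl k s t : tmul (k *: s) t = k *: tmul s t.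
Proof. by rewrite /tmul linearZ. Qed.

Lemma tmulZr k s t : tmul s (k *: t) = k *: tmul s t.
Proof. by rewrite -tliftZ; apply: eq_tlift => u v; rewrite linearZ. Qed.

Lemma tmul_pure (u u' : A) (v v' : B) :
  tmul (u *t v) (u' *t v') = (u * u') *t (v * v').
Proof.
rewrite /tmul tlift_pure => [|x k y z|y k x z]; last 2 first.
- rewrite -tliftZ -tliftD; apply: eq_tlift => p q.
  by rewrite mulrDl -scalerAl tpureDr tpureZr.
- rewrite -tliftZ -tliftD; apply: eq_tlift => p q.
  by rewrite mulrDl -scalerAl tpureDl tpureZl.
rewrite tlift_pure // => [x k y z|y k x z].
  by rewrite mulrDr -scalerAr tpureDr tpureZr.
by rewrite mulrDr -scalerAr tpureDl tpureZl.
Qed.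

Lemma tlift_scale_pure (W : vectType F) (f : {linear W -> F^o}) (u v : W) :
  tlift (fun x y => (f x : F) *: y) (u *t v) = (f u : F) *: v.
Proof.
rewrite tlift_pure // => [x k y z|y k x z].
  by rewrite scalerDr !scalerA mulrC.
by rewrite linearP scalerDl scalerA.
Qed.

Lemma tlift_scaler_pure (W : vectType F) (f : {linear W -> F^o}) (u v : W) :
  tlift (fun x y => (f y : F) *: x) (u *t v) = (f v : F) *: u.
Proof.
rewrite tlift_pure // => [x k y z|y k x z].
  by rewrite linearP scalerDl scalerA.
by rewrite scalerDr !scalerA mulrC.
Qed.

Lemma tlift_mul_pure (W : vectType F) (f g : {linear W -> F^o}) (u v : W) :
  tlift (fun x y => f x * g y : F^o) (u *t v) = f u * g v.
Proof.
rewrite tlift_pure // => [x k y z|y k x z].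
  by rewrite linearP mulrDr scalerAr.
by rewrite linearP mulrDl scalerAl.
Qed.

Lemma tlift_prod_pure (f g : {linear A -> A}) (u v : A) :
  tlift (fun x y => f x * g y) (u *t v) = f u * g v.
Proof.
rewrite tlift_pure // => [x k y z|y k x z].
  by rewrite linearP mulrDr scalerAr.
by rewrite linearP mulrDl scalerAl.
Qed.

End Tensors.

Lemma scale_regularE (R : pzRingType) (k : R) (u : R^o) : k *: u = k * u.
Proof. by []. Qed.

(** * The normal form: coordinates, dual and antipode *)

Definition pointed_basis (F : fieldType) (H : bialgType F) (x : H) (a c : F) :=
  [/\ basis_of {:H} [:: 1; x], x ^+ 2 = a *: x,
      comul x = x *t (1 : H) + (1 : H) *t x + c *: (x *t x) & counit x = 0].

Section AugmentedBasis.
Variables (F : fieldType) (H : bialgType F) (x : H).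
Hypotheses (bx : basis_of {:H} [:: 1; x]) (ex : counit x = 0).

(** The coordinate functional of [x]. Only the basis and [counit x = 0] are assumed in this section,
    so that it applies before the product and coproduct of [x] are known. *)
Definition pointed_coord (h : H) : F^o :=
  coord [tuple 1; x] (@Ordinal 2 1 isT) h.

Lemma pointed_coord_is_linear : linear pointed_coord.
Proof. by move=> k u v; rewrite /pointed_coord linearP. Qed.

HB.instance Definition _ := GRing.isLinear.Build F H F^o _ pointed_coord
  pointed_coord_is_linear.

Local Notation xi := pointed_coord.

Lemma pointed_neq0 : x != 0.
Proof.
by have := basis_free bx; rewrite free_cons seq1_free => /andP[_].
Qed.

Lemma pointed_coord1 : xi 1 = 0.
Proof. exact: (coord_free ord0 (@Ordinal 2 1 isT) (basis_free bx)). Qed.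

Lemma pointed_coordx : xi x = 1.
Proof.
exact: (coord_free (@Ordinal 2 1 isT) (@Ordinal 2 1 isT) (basis_free bx)).
Qed.

Lemma counit_pointed (p q : F) : counit (p *: 1 + q *: x) = p.
Proof.
by rewrite linearD !linearZ /= counit1 ex scaler0 addr0 scale_regularE mulr1.
Qed.

Lemma pointed_coord_comb (p q : F) : xi (p *: 1 + q *: x) = q.
Proof.
rewrite linearD !linearZ /= pointed_coord1 pointed_coordx scaler0 add0r.
by rewrite scale_regularE mulr1.
Qed.

(** The counit is 1 at [1] and 0 at [x], hence it is the other coordinate functional. All structure
    maps can thus be written through [counit] and [xi]. *)
Lemma pointed_decomp h : h = (counit h : F) *: 1 + (xi h : F) *: x.
Proof.
have := coord_basis bx (memvf h).
rewrite big_ord_recl big_ord1 /= => e.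
have e1 : counit h = coord [tuple 1; x] ord0 h.
  by rewrite {1}e counit_pointed.
rewrite e1 [LHS]e; congr (_ + _ *: _).
by rewrite /xi; congr (coord _ _ _); apply: val_inj.
Qed.

End AugmentedBasis.

Section PointedBasis.
Variables (F : fieldType) (H : bialgType F) (x : H) (a c : F).
Hypothesis Hx : pointed_basis x a c.
Local Notation xi := (pointed_coord x).
Let bx : basis_of {:H} [:: 1; x]. Proof. by case: Hx. Qed.
Let ex : counit x = 0. Proof. by case: Hx. Qed.
Let decomp := pointed_decomp bx ex.

Lemma pointed_mul u v : u * v = (counit u * counit v : F) *: 1 +
  ((counit u : F) * xi v + xi u * (counit v : F) + a * (xi u * xi v) : F) *: x.
Proof.
have [_ xx _ _] := Hx.
rewrite {1}(decomp u) {1}(decomp v).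
rewrite mulrDl !mulrDr -!scalerAl -!scalerAr !mul1r !mulr1 -expr2 xx !scalerA.
by rewrite !addrA !scalerDl !addrA [(_ * _) * a]mulrC.
Qed.

Lemma pointed_coordM u v : xi (u * v) =
  (counit u : F) * xi v + xi u * (counit v : F) + a * (xi u * xi v).
Proof. by rewrite {1}pointed_mul (pointed_coord_comb bx). Qed.

Lemma pointed_comul h : comul h = (counit h : F) *: ((1 : H) *t (1 : H)) +
  (xi h : F) *: (x *t (1 : H) + (1 : H) *t x + c *: (x *t x)).
Proof.
have [_ _ dx _] := Hx.
by rewrite {1}(decomp h) linearD !linearZ /= comul1 dx.
Qed.

(** The unit of the dual is [counit]. The square of [xi] at [h] reads the coefficient of [x *t x] in
    [comul h], which is [c * xi h]; and [pointed_coordM], read as a tensor in [counit] and [xi], is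
    the coproduct of [xi], with [a] in front of the square term. *)
Lemma pointed_basis_dual : pointed_basis (linfun xi : dual H) c a.
Proof.
have [_ _ dx _] := Hx.
have E h : dual_eval (linfun xi : dual H) h = xi h by rewrite /dual_eval lfunE.
have basisE (p q : F) h :
  dual_eval (p *: (1 : dual H) + q *: (linfun xi : dual H)) h =
    p * counit h + q * xi h.
  rewrite dual_evalP -[q *: _]addr0 dual_evalP E.
  by rewrite [dual_eval 0 h]zero_lfunE addr0.
split.
- apply/andP; split; last first.
    rewrite free_cons seq1_free; apply/andP; split; last first.
      apply/eqP => /dual_eqP /(_ x); rewrite E (pointed_coordx bx).
      by rewrite /dual_eval zero_lfunE => /eqP; rewrite oner_eq0.
    rewrite span_seq1; apply/vlineP => -[k] /dual_eqP /(_ 1).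
    have := basisE 0 k 1; rewrite scale0r add0r => ->.
    rewrite mul0r add0r (pointed_coord1 bx) mulr0 /dual_eval counit1 => /eqP.
    by rewrite oner_eq0.
  rewrite eqEsubv subvf /=; apply/subvP => phi _.
  (* The coordinates of [phi] on the basis formed by [counit] and [xi] are its values at [1] and
     [x]. *)
  suff -> : phi = (dual_eval phi 1 : F) *: (1 : dual H) +
                (dual_eval phi x : F) *: (linfun xi : dual H).
    by rewrite memvD // memvZ // memv_span ?mem_head // in_cons mem_head orbT.
  apply/dual_eqP => h; rewrite basisE {1}(decomp h) linearD !linearZ /=.
  by congr (_ + _); apply: mulrC.
- apply/dual_eqP => h; have := basisE 0 c h; rewrite scale0r add0r => ->.
  rewrite expr2 dual_mulE mul0r add0r.
  under eq_tlift => u v do rewrite !E.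
  rewrite pointed_comul !linearD !linearZ /= !scale_regularE !tlift_mul_pure.
  rewrite /= (pointed_coord1 bx) (pointed_coordx bx).
  by rewrite !(mulr0, mulr1, mul0r, add0r) mulrC.
- have -> : comul (linfun xi : dual H) = dual_comul_fun (linfun xi : dual H).
    exact: dual_comulE.
  symmetry; apply: dual_comul_uniq => g h.
  rewrite !linearD linearZ /= scale_regularE !dual_pair_pure !E.
  by rewrite pointed_coordM [X in X + _]addrC.
have -> : counit (linfun xi : dual H) = dual_eval (linfun xi) 1.
  exact: dual_counitE.
by rewrite E (pointed_coord1 bx).
Qed.

(** Multiplying the two legs of the coproduct of [x] gives 2 x + c x^2 = (2 + c a) x, which must
    equal [counit x], that is 0. *)
Lemma pointed_antipode_id : 1 + 1 + c * a = 0 -> antipode (\1%VF : 'End(H)).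
Proof.
have [_ xx _ _] := Hx => ca0 h.
have id_lin (u v : H) : tlift (fun p q => p * q) (u *t v) = u * v.
  exact: (@tlift_prod_pure _ _ idfun idfun).
have mul_comul : tlift (fun u v => u * v) (comul h) = (counit h : F)%:A.
  rewrite pointed_comul !linearD !linearZ /= !id_lin.
  rewrite !mulr1 !mul1r -expr2 xx -!scalerDr scalerA.
  have -> : x + x + (c * a) *: x = (1 + 1 + c * a) *: x.
    by rewrite !scalerDl scale1r.
  by rewrite ca0 scale0r scaler0 addr0.
by split; rewrite -[RHS]mul_comul; apply: eq_tlift => u v; rewrite id_lfunE.
Qed.

End PointedBasis.

(** * Every two-dimensional bialgebra has a normal form, which determines it *)

(** The linear map fixing 1 and sending [x] to [y] preserves both coordinates, and product and
    coproduct are formulas in these coordinates involving only [a] and [c]. *)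
Lemma pointed_basis_iso (F : fieldType) (H K : bialgType F) (x : H) (y : K)
    (a c : F) :
  pointed_basis x a c -> pointed_basis y a c -> bialg_iso H K.
Proof.
move=> Hx Hy.
pose f (h : H) : K := (counit h : F) *: 1 + (pointed_coord x h : F) *: y.
pose g (k : K) : H := (counit k : F) *: 1 + (pointed_coord y k : F) *: x.
have [bx _ dx ex] := Hx; have [b_y _ dy ey] := Hy.
have ef h : counit (f h) = counit h.
  exact: counit_pointed.
have eg k : counit (g k) = counit k.
  exact: counit_pointed.
have cf h : pointed_coord y (f h) = pointed_coord x h.
  exact: pointed_coord_comb.
have cg k : pointed_coord x (g k) = pointed_coord y k.
  exact: pointed_coord_comb.
have f_linear : linear f.
  move=> k u v; rewrite /f (linearP counit) (linearP (pointed_coord x)) /=.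
  by rewrite scalerDr !scalerDl !scalerA addrACA.
have f_mult : monoid_morphism f.
  split; first by rewrite /f counit1 (pointed_coord1 bx) scale1r scale0r addr0.
  move=> u v.
  by rewrite (pointed_mul Hy) !ef !cf /f counitM (pointed_coordM Hx).
pose f' : {lrmorphism H -> K} := HB.pack f
  (GRing.isLinear.Build _ _ _ _ _ f_linear)
  (GRing.isMonoidMorphism.Build _ _ _ f_mult).
exists f'; split => [|h|]; last exact: ef.
  exists g => h; rewrite /=.
    by rewrite /g ef cf -(pointed_decomp bx ex).
  by rewrite /f eg cg -(pointed_decomp b_y ey).
rewrite (pointed_comul Hy) (pointed_comul Hx) /= ef cf.
have f1 : f 1 = 1 := f_mult.1.
have fx : f x = y.
  by rewrite /f ex (pointed_coordx bx) scale1r scale0r add0r.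
rewrite !linearD !linearZ /=.
by rewrite !(@tmap_pure _ _ _ _ _ f' f') /= f1 fx scalerA mulrC -scalerA.
Qed.

Lemma exists_pointed_basis (F : fieldType) (H : bialgType F) :
  \dim {:H} = 2%N -> exists (x : H) (a c : F), pointed_basis x a c.
Proof.
move=> dimH.
(* An element outside the line of 1, minus its counit, is a nonzero element of the augmentation
   ideal. *)
have [x x0 ex] : exists2 x : H, x != 0 & counit x = 0.
  have [z zn1] : exists z : H, z \notin <[1]>%VS.
    have : ~~ ({:H} <= <[1 : H]>)%VS.
      by apply/negP => /dimvS; rewrite dimH dim_vline oner_neq0.
    by case/subvPn => z _; exists z.
  exists (z - (counit z : F) *: 1).
    apply: contraNneq zn1 => /eqP; rewrite subr_eq0 => /eqP ->.
    by rewrite memvZ // memv_line.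
  by rewrite linearB linearZ /= counit1 scale_regularE mulr1 subrr.
have bx : basis_of {:H} [:: 1; x].
  rewrite basisEfree dimH subvf /= andbT free_cons seq1_free x0 andbT.
  rewrite span_seq1; apply/vlineP => -[k] /(congr1 counit).
  by rewrite counit1 linearZ /= ex scaler0 => /eqP; rewrite oner_eq0.
have dec := pointed_decomp bx ex.
have [a xx] : exists a : F, x ^+ 2 = a *: x.
  exists (pointed_coord x (x ^+ 2)).
  by rewrite [LHS]dec expr2 counitM ex mulr0 scale0r add0r.
have tdec (t : tensor H H) : exists p q r c : F, t = p *: ((1 : H) *t (1 : H)) +
    q *: (x *t (1 : H)) + r *: ((1 : H) *t x) + c *: (x *t x).
  rewrite (tensorE t); pose P (t : tensor H H) := exists p q r c : F,
    t = p *: ((1 : H) *t (1 : H)) + q *: (x *t (1 : H)) +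
        r *: ((1 : H) *t x) + c *: (x *t x).
  rewrite -/(P _); have P0 : P 0.
    by exists 0, 0, 0, 0; rewrite !scale0r !addr0.
  have PD u v : P u -> P v -> P (u + v).
    move=> [p [q [r [c ->]]]] [p' [q' [r' [c' ->]]]].
    exists (p + p'), (q + q'), (r + r'), (c + c'); rewrite !scalerDl.
    rewrite [LHS]addrACA; congr (_ + _).
    by rewrite [LHS]addrACA [X in X + _]addrACA.
  apply: big_ind => // i _; apply: big_ind => // j _.
  move: _`_i _`_j => u v.
  rewrite (dec u) (dec v) !tpureDl !tpureDr !tpureZl !tpureZr.
  rewrite !addrA !scalerDr !scalerA.
  by rewrite [X in X + _]addrAC; do 4 eexists.
exists x, a.
have [p [q [r [c dx]]]] := tdec (comul x); exists c; split=> //.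
have coef (k l : F) : k *: 1 + l *: x = x -> k = 0 /\ l = 1.
  move=> e; split; first by rewrite -(counit_pointed ex k l) e.
  by rewrite -(pointed_coord_comb bx k l) e (pointed_coordx bx).
(* The left counit law leaves p 1 + r x = x and the right one p 1 + q x = x, so only [c] stays
   free. *)
have := counitl x; rewrite dx !linearD !linearZ /= !tlift_scale_pure /=.
rewrite counit1 ex !scale1r !scale0r !scaler0 !addr0 => /coef[-> ->].
have := counitr x; rewrite dx !linearD !linearZ /= !tlift_scaler_pure /=.
rewrite counit1 ex !scale1r !scale0r !scaler0 !addr0 => /coef[_ ->].
by rewrite add0r scale1r.
Qed.

(** * Construction of a bialgebra with prescribed parameters *)

Lemma scaler_comb_linear (R : pzRingType) (V : lmodType R) (X Y : V)
    (k p q p' q' : R) :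
  (k * p + p') *: X + (k * q + q') *: Y =
  k *: (p *: X + q *: Y) + (p' *: X + q' *: Y).
Proof. by rewrite scalerDr !scalerA addrACA -!scalerDl. Qed.

Section PointedComul.
Variables (F : fieldType) (A : falgType F) (x : A) (a c : F).
Local Notation Dx := (x *t (1 : A) + (1 : A) *t x + c *: (x *t x)).

(** The coproduct of [x] is the formal group law X + Y + c X Y, which is associative for every
    [c]. *)
Lemma coassoc_pointed (D : 'Hom(A, tensor A A)) :
  D 1 = (1 : A) *t (1 : A) -> D x = Dx ->
  forall p q : F, let h := p *: 1 + q *: x in
  tassoc (tmap D idfun (D h)) = tmap idfun D (D h).
Proof.
move=> D1 Dgen p q /=.
have L u v : tmap D idfun (u *t v) = D u *t v by exact: tmap_pure.
have R u v : tmap idfun D (u *t v) = u *t D v by exact: tmap_pure.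
rewrite !linearD !linearZ /= D1 Dgen.
rewrite !linearD !linearZ /= !L !R D1 Dgen.
rewrite !(tpureDl, tpureDr, tpureZl, tpureZr) !linearD !linearZ /=.
rewrite !tassoc_pure3 !scalerA ![c * q]mulrC; congr (_ + _).
by rewrite [LHS](AC (4*3) ((1*(2*4*6))*(3*5*7))).
Qed.

(* The scalar condition, (1 + a c) (2 + a c) = 0, is the comparison of the
   coefficients of x (x) x. *)
Lemma tmul_pointed : x ^+ 2 = a *: x ->
  1 + 1 + (1 + 1 + 1) * (a * c) + (a * c) ^+ 2 = 0 -> tmul Dx Dx = a *: Dx.
Proof.
move=> xx ac.
rewrite !(tmulDl, tmulDr, tmulZl, tmulZr, tmul_pure) !mulr1 !mul1r -!expr2.
rewrite !xx !(tpureZl, tpureZr).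
rewrite !scalerA !scalerDr !scalerA.
rewrite [LHS](AC (3*3*3) ((1*5)*(2*4*3*6*7*8*9))); congr (_ + _).
rewrite /=; have -> : x *t x + x *t x = (1 + 1) *: (x *t x).
  by rewrite scalerDl scale1r.
rewrite -!scalerDl; congr (_ *: _).
apply/eqP; rewrite -subr_eq0 -[X in _ == X]ac; apply/eqP; ring.
Qed.

Lemma tmul_pointed_comb (p q p' q' : F) : x ^+ 2 = a *: x ->
  1 + 1 + (1 + 1 + 1) * (a * c) + (a * c) ^+ 2 = 0 ->
  tmul (p *: ((1 : A) *t (1 : A)) + q *: Dx)
       (p' *: ((1 : A) *t (1 : A)) + q' *: Dx) =
  (p * p') *: ((1 : A) *t (1 : A)) + (p * q' + q * p' + a * (q * q')) *: Dx.
Proof.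
move=> xx ac; have DD := tmul_pointed xx ac.
have lD : tmul (1 *t 1) Dx = Dx.
  by rewrite !(tmulDr, tmulZr, tmul_pure) !mul1r.
have Dr : tmul Dx (1 *t 1) = Dx.
  by rewrite !(tmulDl, tmulZl, tmul_pure) !mulr1.
(* From here on [Dx] is an opaque element, known only through its square and the unit laws. *)
move: Dx DD lD Dr => D DD lD Dr.
rewrite !(tmulDl, tmulDr, tmulZl, tmulZr) DD lD Dr tmul_pure !mulr1.
by rewrite !scalerA -!addrA -!scalerDl; congr (_ *: _ + _ *: _); ring.
Qed.

Lemma counitl_pointed (e : 'Hom(A, F^o)) (p q : F) : e 1 = 1 -> e x = 0 ->
  tlift (fun u v => (e u : F) *: v) (p *: (1 *t 1) + q *: Dx) =
  p *: 1 + q *: x.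
Proof.
move=> e1 ex; rewrite !linearD !linearZ /= !tlift_scale_pure /= e1 ex.
by rewrite !scale0r !scale1r !scaler0 !addr0 add0r.
Qed.

Lemma counitr_pointed (e : 'Hom(A, F^o)) (p q : F) : e 1 = 1 -> e x = 0 ->
  tlift (fun u v => (e v : F) *: u) (p *: (1 *t 1) + q *: Dx) =
  p *: 1 + q *: x.
Proof.
move=> e1 ex; rewrite !linearD !linearZ /= !tlift_scaler_pure /= e1 ex.
by rewrite !scale0r !scale1r !scaler0 !addr0.
Qed.

End PointedComul.

(* The pair (p, q) stands for p + q x.  The casts to B below keep unification
   from unfolding bialg2 and finding the componentwise product of pairs. *)
Definition bialg2 (a c : 'F_2) : Type := (('F_2)^o * ('F_2)^o)%type.

HB.instance Definition _ (a c : 'F_2) :=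
  Vector.copy (bialg2 a c) (('F_2)^o * ('F_2)^o)%type.

Section Bialg2.
Variables a c : 'F_2.
Local Notation B := (bialg2 a c).

Definition bialg2_one : B := (1, 0).
(** The product of F_2[x] / (x^2 - a x). *)
Definition bialg2_mul (u v : B) : B :=
  (u.1 * v.1, u.1 * v.2 + u.2 * v.1 + (a : ('F_2)^o) * (u.2 * v.2)).

Lemma bialg2_mulA : associative bialg2_mul.
Proof. by move=> [u u'] [v v'] [w w']; congr (_, _) => /=; ring. Qed.

Lemma bialg2_mulC : commutative bialg2_mul.
Proof. by move=> [u u'] [v v']; congr (_, _) => /=; ring. Qed.

Lemma bialg2_mul1 : left_id bialg2_one bialg2_mul.
Proof. by move=> [u u']; congr (_, _) => /=; ring. Qed.

Lemma bialg2_mulDl : left_distributive bialg2_mul +%R.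
Proof. by move=> [u u'] [v v'] [w w']; congr (_, _) => /=; ring. Qed.

Lemma bialg2_one_neq0 : bialg2_one != 0.
Proof. by []. Qed.

HB.instance Definition _ := GRing.Zmodule_isComNzRing.Build B
  bialg2_mulA bialg2_mulC bialg2_mul1 bialg2_mulDl bialg2_one_neq0.

Lemma bialg2_scalerAl (k : 'F_2) (u v : B) : k *: (u * v) = (k *: u : B) * v.
Proof.
by case: u v => [u u'] [v v']; congr (_, _) => /=; rewrite !scale_regularE; ring.
Qed.

HB.instance Definition _ :=
  GRing.Lmodule_isLalgebra.Build 'F_2 B bialg2_scalerAl.

Lemma bialg2_scalerAr (k : 'F_2) (u v : B) : k *: (u * v) = u * (k *: v : B).
Proof. by rewrite ![u * _]mulrC bialg2_scalerAl. Qed.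

HB.instance Definition _ :=
  GRing.Lalgebra_isAlgebra.Build 'F_2 B bialg2_scalerAr.
HB.instance Definition _ := Algebra_isFalgebra.Build 'F_2 B.

Definition bialg2_gen : B := (0, 1).
Local Notation x := bialg2_gen.
Local Notation Dx := (x *t (1 : B) + (1 : B) *t x + c *: (x *t x)).

Lemma bialg2_decomp (h : B) : h = (h.1 : 'F_2) *: 1 + (h.2 : 'F_2) *: x.
Proof.
by case: h => h h'; congr (_, _) => /=; rewrite !scale_regularE; ring.
Qed.

Definition bialg2_comul_fun (h : B) : tensor B B :=
  (h.1 : 'F_2) *: ((1 : B) *t (1 : B)) + (h.2 : 'F_2) *: Dx.

Lemma bialg2_comul_fun_is_linear : linear bialg2_comul_fun.
Proof. by move=> k u v; apply: scaler_comb_linear. Qed.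

HB.instance Definition _ := GRing.isLinear.Build 'F_2 B (tensor B B) _
  bialg2_comul_fun bialg2_comul_fun_is_linear.

Definition bialg2_comul : 'Hom(B, tensor B B) := linfun bialg2_comul_fun.

Definition bialg2_counit_fun (h : B) : ('F_2)^o := h.1.

Lemma bialg2_counit_fun_is_linear : linear bialg2_counit_fun.
Proof. by []. Qed.

HB.instance Definition _ := GRing.isLinear.Build 'F_2 B ('F_2)^o _
  bialg2_counit_fun bialg2_counit_fun_is_linear.

Definition bialg2_counit : 'Hom(B, ('F_2)^o) := linfun bialg2_counit_fun.

Lemma bialg2_comulE h : bialg2_comul h = bialg2_comul_fun h.
Proof. exact: lfunE. Qed.

Lemma bialg2_counitE h : bialg2_counit h = h.1.
Proof. exact: lfunE. Qed.

Lemma bialg2_comul1 : bialg2_comul 1 = (1 : B) *t (1 : B).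
Proof. by rewrite bialg2_comulE /bialg2_comul_fun scale1r scale0r addr0. Qed.

Lemma bialg2_comul_gen : bialg2_comul x = Dx.
Proof. by rewrite bialg2_comulE /bialg2_comul_fun scale1r scale0r add0r. Qed.

Lemma bialg2_sqr_gen : x * x = a *: x.
Proof. by congr (_, _) => /=; rewrite !scale_regularE; ring. Qed.

Lemma bialg2_comulA h : tassoc (tmap bialg2_comul idfun (bialg2_comul h)) =
  tmap idfun bialg2_comul (bialg2_comul h).
Proof.
rewrite (bialg2_decomp h).
exact: coassoc_pointed bialg2_comul1 bialg2_comul_gen _ _.
Qed.

Lemma bialg2_counitl h :
  tlift (fun u v => (bialg2_counit u : 'F_2) *: v) (bialg2_comul h) = h.
Proof.
rewrite bialg2_comulE [RHS]bialg2_decomp.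
by apply: counitl_pointed; apply: bialg2_counitE.
Qed.

Lemma bialg2_counitr h :
  tlift (fun u v => (bialg2_counit v : 'F_2) *: u) (bialg2_comul h) = h.
Proof.
rewrite bialg2_comulE [RHS]bialg2_decomp.
by apply: counitr_pointed; apply: bialg2_counitE.
Qed.

Lemma bialg2_comulM u v :
  bialg2_comul (u * v) = tmul (bialg2_comul u) (bialg2_comul v).
Proof.
rewrite !bialg2_comulE; symmetry; apply: tmul_pointed_comb.
  exact: bialg2_sqr_gen.
(* With t = a c the condition 2 + 3 t + t^2 = 0 reads t + t^2 = 0, which holds throughout F_2. *)
by move: a c => [[|[|//]] ?] [[|[|//]] ?]; apply/val_inj.
Qed.

Lemma bialg2_counit1 : bialg2_counit 1 = 1.
Proof. by rewrite bialg2_counitE. Qed.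

Lemma bialg2_counitM u v :
  bialg2_counit (u * v) = bialg2_counit u * bialg2_counit v.
Proof. by rewrite !bialg2_counitE. Qed.

HB.instance Definition _ := isBialgebra.Build 'F_2 B bialg2_comulA
  bialg2_counitl bialg2_counitr bialg2_comul1 bialg2_comulM
  bialg2_counit1 bialg2_counitM.

Lemma bialg2_pointed_basis : pointed_basis bialg2_gen a c.
Proof.
split.
- rewrite basisEdim dimvf andbT.
  apply/subvP => h _; rewrite (bialg2_decomp h).
  by rewrite memvD // memvZ // memv_span ?mem_head // in_cons mem_head orbT.
- exact: bialg2_sqr_gen.
- exact: bialg2_comul_gen.
- exact: bialg2_counitE.
Qed.

End Bialg2.

(** * Over F_2 the parameters are invariants *)

Lemma F2_cases (k : 'F_2) : k = 0 \/ k = 1.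
Proof. by case: k => [[|[|//]] ?]; [left | right]; apply/val_inj. Qed.

Lemma pointed_basis_iso_eq (H K : bialgType 'F_2) (x : H) (y : K)
    (a c a' c' : 'F_2) : pointed_basis x a c -> pointed_basis y a' c' ->
  bialg_iso H K -> a = a' /\ c = c'.
Proof.
move=> Hx Hy [f [f_bij comul_f counit_f]].
have [bx xx dx ex] := Hx; have [by_ yy dy ey] := Hy.
have x0 := pointed_neq0 bx; have y0 := pointed_neq0 by_.
(* [f x] has counit 0, so it is a multiple of [y], nonzero by injectivity, and 1 is the only nonzero
   scalar. *)
have fx : f x = y.
  have := pointed_decomp by_ ey (f x).
  rewrite counit_f ex scale0r add0r.
  case: (F2_cases (pointed_coord y (f x))) => -> e; last by rewrite e scale1r.
  case/eqP: x0; apply: (bij_inj f_bij).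
  by rewrite e scale0r linear0.
split.
  have := congr1 f xx; rewrite rmorphXn linearZ /= fx yy.
  move=> /eqP; rewrite -subr_eq0 -scalerBl scaler_eq0 (negPf y0) orbF.
  by rewrite subr_eq0 => /eqP.
have := comul_f x.
rewrite fx dy dx !linearD !linearZ /= !(@tmap_pure _ _ _ _ _ f f) /= fx rmorph1.
(* The linear terms cancel, and [c], [c'] are compared as coefficients of the nonzero tensor
   [y *t y]. *)
move=> /addrI /eqP; rewrite -subr_eq0 -scalerBl scaler_eq0 => /orP[|/eqP].
  by rewrite subr_eq0 => /eqP.
by case/tpure_eq0 => e; rewrite e eqxx in y0.
Qed.

(** * The element [1 + x]; group and function algebras of Z/2 *)

Lemma char2_addrr (H : lmodType 'F_2) (h : H) : h + h = 0.
Proof.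
by rewrite -[h]scale1r -scalerDl (_ : 1 + 1 = 0) ?scale0r //; apply: val_inj.
Qed.

Lemma pointed_basis_1D (F : fieldType) (H : bialgType F) (x : H) (a c : F) :
  pointed_basis x a c -> basis_of {:H} [:: 1; 1 + x].
Proof.
case=> + _ _ _; rewrite !basisEdim => /andP[sp ->]; rewrite andbT.
apply: subv_trans sp _; apply/span_subvP => h.
rewrite !inE => /orP[]/eqP->; first by rewrite memv_span ?mem_head.
have : (1 + x) - 1 \in <<[:: 1%R; (1 + x)%R]>>%VS.
  by apply: memvB; apply: memv_span; rewrite !inE eqxx ?orbT.
by rewrite [X in X \in _]addrC addKr.
Qed.

(** For [c = 1], adding [1 *t 1] to the coproduct of [x] completes it to the pure tensor
    [(1 + x) *t (1 + x)]. *)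
Lemma pointed_grouplike_1D (F : fieldType) (H : bialgType F) (x : H) (a : F) :
  pointed_basis x a 1 -> grouplike (1 + x).
Proof.
move=> [_ _ dx ex]; split; last by rewrite linearD /= counit1 ex addr0.
rewrite linearD /= comul1 dx scale1r !tpureDl !tpureDr !addrA.
by congr (_ + _); apply: addrAC.
Qed.

Lemma pointed_sqr_1D (H : bialgType 'F_2) (x : H) (a c : 'F_2) :
  pointed_basis x a c -> (1 + x) ^+ 2 = 1 + a *: x.
Proof.
move=> [_ xx _ _]; rewrite -xx !expr2 mulrDl !mulrDr !mulr1 !mul1r.
by rewrite -addrA [x + (x + _)]addrA char2_addrr add0r.
Qed.

Lemma Z2_cases (g : 'Z_2) : g = 0 \/ g = 1.
Proof. by case: g => [[|[|//]] ?]; [left | right]; apply/val_inj. Qed.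

Lemma group_bialg_Z2 (H : bialgType 'F_2) (x : H) : pointed_basis x 0 1 ->
  exists2 e : 'Z_2 -> H, group_bialg e & e 1 = 1 + x.
Proof.
move=> Hx; exists (fun g => if g == 0 then 1 else 1 + x) => //; split=> //.
- rewrite (_ : [seq _ | g <- enum 'Z_2] = [:: 1; 1 + x]).
    exact: pointed_basis_1D Hx.
  by rewrite enum_ordSl enum_ordSl enum_ord0.
- move=> g h; case: (Z2_cases g) => ->; case: (Z2_cases h) => -> /=;
    rewrite ?mulr1 ?mul1r //.
  by rewrite -expr2 (pointed_sqr_1D Hx) scale0r addr0.
move=> g; case: (Z2_cases g) => -> /=; last exact: pointed_grouplike_1D Hx.
by split; [exact: comul1 | exact: counit1].
Qed.

Lemma function_bialg_Z2 (H : bialgType 'F_2) (x : H) : pointed_basis x 1 0 ->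
  exists theta : {linear H -> {ffun 'Z_2 -> ('F_2)^o}}, function_bialg theta.
Proof.
move=> Hx; have [bx xx dx ex] := Hx.
(* 1 goes to the constant function 1, and [x], idempotent here, to the indicator of the nonzero
   element. *)
pose t (h : H) : {ffun 'Z_2 -> ('F_2)^o} :=
  [ffun g => counit h + (if g == 0 then 0 else pointed_coord x h)].
have t_linear : linear t.
  move=> k u v; apply/ffunP => g; rewrite !ffunE !linearP /=.
  by case: ifP => _; rewrite !scale_regularE; ring.
pose theta : {linear H -> {ffun 'Z_2 -> ('F_2)^o}} :=
  HB.pack t (GRing.isLinear.Build _ _ _ _ _ t_linear).
exists theta; split.
- exists (fun p : {ffun 'Z_2 -> ('F_2)^o} =>
    (p 0 : 'F_2) *: 1 + (p 1 - p 0 : 'F_2) *: x) => [h|p] /=.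
    rewrite !ffunE /= addr0 [counit h + _]addrC addrK.
    by rewrite -(pointed_decomp bx ex).
  apply/ffunP => g; rewrite !ffunE !linearD !linearZ /= counit1 ex.
  rewrite (pointed_coord1 bx) (pointed_coordx bx) !scale_regularE.
  by case: (Z2_cases g) => -> /=; ring.
- move=> g; rewrite /= ffunE counit1 (pointed_coord1 bx).
  by case: ifP; rewrite addr0.
- move=> u v g; rewrite /= !ffunE counitM (pointed_coordM Hx).
  by case: ifP => _; ring.
- move=> u g h; rewrite (pointed_comul Hx) !scale0r addr0.
  have theta_lin k : linear (fun v => theta v k : ('F_2)^o).
    by move=> r v w; rewrite linearP !ffunE.
  pose L k : {linear H -> ('F_2)^o} := HB.pack (fun v => theta v k : ('F_2)^o)
    (GRing.isLinear.Build _ _ _ _ _ (theta_lin k)).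
  rewrite !linearD !linearZ /=.
  rewrite !(@tlift_mul_pure _ _ (L g) (L h)) /= !ffunE /=.
  rewrite counit1 ex (pointed_coord1 bx) (pointed_coordx bx) !scale_regularE.
  case: (Z2_cases g) => ->; case: (Z2_cases h) => -> /=; try by ring.
  (* The case g = h = 1: the group sum is 0, and the two copies of the coordinate of [u] cancel in
     characteristic two. *)
  rewrite !addr0 !add0r !mulr1 -[RHS]addr0; congr (_ + _).
  by case: (F2_cases (pointed_coord x u)) => ->; apply: val_inj.
by move=> u; rewrite /= ffunE addr0.
Qed.

(* A grouplike idempotent other than 1 is not invertible, whereas an antipode
   would invert it. *)
Lemma idempotent_grouplike_not_hopf (F : fieldType) (H : bialgType F) (y : H) :
  grouplike y -> y ^+ 2 = y -> y != 1 -> ~ is_hopf H.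
Proof.
move=> [dy ey] yy y1 [S /(_ y) [+ _]].
rewrite dy (@tlift_prod_pure _ _ S idfun) /= ey scale1r => Sy.
case/eqP: y1.
by rewrite -[LHS]mul1r -{1}Sy -mulrA -expr2 yy.
Qed.

Theorem mainTheorem2 :
  exists (B1 B2 B3 B4 : bialgType 'F_2) (x1 : B1) (x2 : B2) (x3 : B3) (x4 : B4),
    (* the four bialgebras, presented on the basis 1, x *)
    [/\ [/\ basis_of {:B1} [:: 1; x1], x1 ^+ 2 = 0,
            comul x1 = x1 *t (1 : B1) + (1 : B1) *t x1 + x1 *t x1 & counit x1 = 0],
        [/\ basis_of {:B2} [:: 1; x2], x2 ^+ 2 = 0,
            comul x2 = x2 *t (1 : B2) + (1 : B2) *t x2 & counit x2 = 0],
        [/\ basis_of {:B3} [:: 1; x3], x3 ^+ 2 = x3,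
            comul x3 = x3 *t (1 : B3) + (1 : B3) *t x3 & counit x3 = 0]
      & [/\ basis_of {:B4} [:: 1; x4], x4 ^+ 2 = x4,
            comul x4 = x4 *t x4 & counit x4 = 1]] /\
    (* every bialgebra of dimension 2 is isomorphic to one of them *)
    (forall H : bialgType 'F_2, \dim {:H} = 2%N ->
       [\/ bialg_iso H B1, bialg_iso H B2, bialg_iso H B3 | bialg_iso H B4]) /\
    (* and they are pairwise non-isomorphic *)
    [/\ ~ bialg_iso B1 B2, ~ bialg_iso B1 B3 & ~ bialg_iso B1 B4] /\
    [/\ ~ bialg_iso B2 B3, ~ bialg_iso B2 B4 & ~ bialg_iso B3 B4] /\
    (* the group algebra and the function algebra of Z/2 *)
    (exists2 e : 'Z_2 -> B1, group_bialg e & e 1 = 1 + x1) /\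
    grouplike (1 + x1) /\
    (exists theta : {linear B3 -> {ffun 'Z_2 -> ('F_2)^o}}, function_bialg theta) /\
    (* Hopf algebras *)
    [/\ is_hopf B1, is_hopf B2, is_hopf B3 & ~ is_hopf B4] /\
    [/\ antipode (\1%VF : 'End(B1)), antipode (\1%VF : 'End(B2))
      & antipode (\1%VF : 'End(B3))] /\
    (* duality *)
    [/\ self_dual B2, self_dual B4, bialg_iso (dual B1) B3
      & bialg_iso (dual B3) B1].
Proof.
have H1 := bialg2_pointed_basis 0 1; have H2 := bialg2_pointed_basis 0 0.
have H3 := bialg2_pointed_basis 1 0; have H4 := bialg2_pointed_basis 1 1.
set x1 := bialg2_gen 0 1 in H1; set x2 := bialg2_gen 0 0 in H2.
set x3 := bialg2_gen 1 0 in H3; set x4 := bialg2_gen 1 1 in H4.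
have antipode1 : antipode (\1%VF : 'End(bialg2 0 1)).
  by apply: pointed_antipode_id H1 _; apply: val_inj.
have antipode2 : antipode (\1%VF : 'End(bialg2 0 0)).
  by apply: pointed_antipode_id H2 _; apply: val_inj.
have antipode3 : antipode (\1%VF : 'End(bialg2 1 0)).
  by apply: pointed_antipode_id H3 _; apply: val_inj.
have grouplike4 := pointed_grouplike_1D H4.
have sqr4 : (1 + x4) ^+ 2 = 1 + x4.
  by rewrite (pointed_sqr_1D H4) scale1r.
(* The arguments are the pairs (a, c). The fourth generator is shifted by 1, since presentation (4)
   asks for a grouplike element rather than one of counit 0. *)
exists (bialg2 0 1 : bialgType 'F_2), (bialg2 0 0 : bialgType 'F_2),
  (bialg2 1 0 : bialgType 'F_2), (bialg2 1 1 : bialgType 'F_2),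
  x1, x2, x3, (1 + x4).
split; [|split; [|split; [|split; [|split; [|split; [|split; [|split; [|split]]]]]]]].
- split.
  + have [bx xx dx ex] := H1; split=> //; first by rewrite xx scale0r.
    by rewrite dx scale1r.
  + have [bx xx dx ex] := H2; split=> //; first by rewrite xx scale0r.
    by rewrite dx scale0r addr0.
  + have [bx xx dx ex] := H3; split=> //; first by rewrite xx scale1r.
    by rewrite dx scale0r addr0.
  + have [dx ex] := grouplike4; split=> //; exact: pointed_basis_1D H4.
- move=> H /exists_pointed_basis[x [a [c]]].
  case: (F2_cases a) => ->; case: (F2_cases c) => -> Hx.
  + by apply: Or42; apply: pointed_basis_iso Hx H2.
  + by apply: Or41; apply: pointed_basis_iso Hx H1.
  + by apply: Or43; apply: pointed_basis_iso Hx H3.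
  + by apply: Or44; apply: pointed_basis_iso Hx H4.
- split.
  + by move=> /(pointed_basis_iso_eq H1 H2)[].
  + by move=> /(pointed_basis_iso_eq H1 H3)[].
  + by move=> /(pointed_basis_iso_eq H1 H4)[].
- split.
  + by move=> /(pointed_basis_iso_eq H2 H3)[].
  + by move=> /(pointed_basis_iso_eq H2 H4)[].
  + by move=> /(pointed_basis_iso_eq H3 H4)[].
- exact: group_bialg_Z2 H1.
- exact: pointed_grouplike_1D H1.
- exact: function_bialg_Z2 H3.
- split; [exact: ex_intro antipode1 | exact: ex_intro antipode2
         | exact: ex_intro antipode3 |].
  apply: idempotent_grouplike_not_hopf grouplike4 sqr4 _.
  rewrite -subr_eq0 addrC addKr; apply: pointed_neq0.
  by case: H4.
- exact: And3 antipode1 antipode2 antipode3.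
split.
- exact: pointed_basis_iso H2 (pointed_basis_dual H2).
- exact: pointed_basis_iso H4 (pointed_basis_dual H4).
- exact: pointed_basis_iso (pointed_basis_dual H1) H3.
- exact: pointed_basis_iso (pointed_basis_dual H3) H1.
Qed.
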